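(* Let $M(n)$ be the maximum size of an even-intersecting family of permutations in $S_n$. There exist absolute constants $C>0$ and $n_0\in\mathbb{N}$ such that, for every even $n\geq n_0$, $$n!!\leq M(n)\leq e^{\frac{n}{2}+C n^{3/4}\log n}\,n!!,$$ where the lower bound is attained by the family $\mathcal{F}=S_2\wr S_{n/2}$ (that is, $S_2\wr S_{n/2}\subseteq S_n$ is an even-intersecting family of size $n!!$).
   Context: $S_n$ is the symmetric group on $[n]=\{1,\dots,n\}$. For $\sigma,\pi\in S_n$, $\sigma\cap\pi=\{i\in[n]:\sigma(i)=\pi(i)\}$. A family $\mathcal{F}\subseteq S_n$ is even-intersecting if $|\sigma\cap\pi|$ is even for every two distinct $\sigma,\pi\in\mathcal{F}$. $M(n)=\max\{|\mathcal{F}|:\mathcal{F}\subseteq S_n\text{ is even-intersecting}\}$. For even $n$, $n!!=n(n-2)\cdots 4\cdot 2=2^{n/2}(n/2)!$. For $n=2m$, the wreath product $S_2\wr S_m\le S_n$ is the subgroup of all permutations of $[n]$ preserving the partition of $[n]$ into the pairs $\{2i-1,2i\}$, $1\le i\le m$. *)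

(* Defs.v *)
From mathcomp Require Import all_boot all_fingroup.

Set Implicit Arguments.
Unset Strict Implicit.
Unset Printing Implicit Defensive.

Local Open Scope group_scope.

(* The ground set [n] is 'I_n, i.e. {0, .., n-1}: all indices are shifted     *)
(* down by one.                                                               *)

Definition agreement n (s t : 'S_n) : {set 'I_n} := [set i | s i == t i].

Definition even_intersecting n (F : {set 'S_n}) : bool :=
  [forall s in F, forall t in F, (s != t) ==> ~~ odd #|agreement s t|].

Definition max_even_intersecting n : nat :=
  \max_(F : {set 'S_n} | even_intersecting F) #|F|.

Fixpoint double_fact n : nat :=
  if n is m.+2 then (n * double_fact m)%N else 1%N.

(* After the index shift the k-th pair is {2k, 2k+1}, 0 <= k < n/2; these     *)
(* pairs partition 'I_n when n is even, the only case of interest.            *)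
Definition pair_partition n : {set {set 'I_n}} :=
  [set [set i : 'I_n | (i == k.*2 :> nat) || (i == k.*2.+1 :> nat)]
     | k : 'I_n./2].

(* S_2 wr S_(n/2) as the setwise stabiliser of the pairs, for the action of   *)
(* permutations on subsets of 'I_n by direct image.                           *)
Definition wreath_S2 n : {group 'S_n} := 'N(pair_partition n | ('P)^* )%G.

(* Main.v *)
Require Import Defs.
From mathcomp Require Import all_boot all_order all_algebra all_fingroup.
From mathcomp Require Import all_classical all_reals all_analysis.
From mathcomp Require Import ring.

(** The upper bound holds in the sharper form |F| <= n ^ (n / 2) for even
    n >= 4. As m ^ m / m! is a term of the series of exp m, one has
    n ^ (n / 2) = 2 ^ m * m ^ m <= exp m * 2 ^ m * m! for n = 2m, and the last
    factor 2 ^ m * m! is n!!.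

    To bound F, reveal a permutation s in F one value at a time, and let A_i(s)
    be the set of values at i of the members of F that agree with s before i.
    Guessing each next value uniformly among the possible ones produces s with
    probability \prod_i 1 / |A_i(s)|, so these weights have sum at most 1 over F
    ([sum_branches_le1]). The same holds for the sets B_i(s) obtained by
    revealing s from the last point to the first.

    The intersection hypothesis links both orders. Let t agree with s before i
    and u agree with s after i. At any point other than i, one or all three of
    the pairs among s, t, u agree. The three agreement sets have even sizes,
    and there are n - 1 (an odd number) such points, so an odd number of pairs
    agrees at i as well: if t and u both differ from s at i, then t i = u i
    ([two_sided_unique]). Hence either one of A_i(s), B_i(s) is a singleton, or
    both have two elements, and |A_i(s)| |B_i(s)| <= max n 4 = n.
    The two weights of s thus have product at least n ^ (- n), hence sum at
    least 2 n ^ (- n / 2); summing over s in F gives |F| <= n ^ (n / 2).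

    For the lower bound, the wreath product is the centraliser of the
    involution swapping the two points of each pair ([mem_wreath_S2]). The
    agreement set of two elements of this centraliser is stable under that
    fixed-point-free involution, so its size is even; and an element amounts to
    a permutation of the n / 2 pairs and a bit for each pair, whence the order
    2 ^ (n / 2) * (n / 2)!. *)

Import Order.TTheory GRing.Theory Num.Theory.
Local Open Scope ring_scope.

Set Implicit Arguments.
Unset Strict Implicit.
Unset Printing Implicit Defensive.

(** * Revealing a function one value at a time *)

Definition branches n (T U : finType) (f : T -> 'I_n -> U) (F : {set T}) s i :
    {set U} :=
  [set f t i | t in F & [forall (j : 'I_n | (j < i)%N), f t j == f s j]].

Lemma branches_ord0 n (T U : finType) (f : T -> 'I_n.+1 -> U) (F : {set T}) s :
  branches f F s ord0 = [set f t ord0 | t in F].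
Proof.
apply/setP => x; apply/imsetP/imsetP => [] [t].
- by rewrite inE => /andP[tF _] ->; exists t.
- by move=> tF ->; exists t; rewrite // inE tF; apply/forall_inP.
Qed.

(** Fixing the value at 0 leaves the same problem for the fibre of that value,
    with one coordinate less. *)
Lemma branches_lift n (T U : finType) (f : T -> 'I_n.+1 -> U) (F : {set T})
    s i :
  branches f F s (lift ord0 i) =
  branches (fun t j => f t (lift ord0 j))
    [set t in F | f t ord0 == f s ord0] s i.
Proof.
rewrite /branches; set S := [set t in F | _]; set S' := [set t in _ | _].
suff -> : S = S' by [].
apply/setP => t; rewrite !inE -andbA.
congr (_ && _); apply/forall_inP/andP => [agr|[agr0 /forall_inP agr] j].
- split; first exact: agr.
  by apply/forall_inP => j ltji; apply: agr; rewrite /= /bump !leq0n ltnS.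
- by case: (unliftP ord0 j) => [k|] -> // /[!ltnS]; apply: agr.
Qed.

(** Each summand is the probability of obtaining s when every value in turn is
    drawn uniformly among those compatible with the previous draws; distinct
    members of F are disjoint outcomes by the injectivity hypothesis. *)
Lemma sum_branches_le1 (K : numFieldType) n (T U : finType)
    (f : T -> 'I_n -> U) (F : {set T}) :
    {in F &, forall s t, f s =1 f t -> s = t} ->
  \sum_(s in F) \prod_(i < n) (#|branches f F s i|%:R)^-1 <= 1 :> K.
Proof.
elim: n => [|n IHn] in f F * => injf.
  under eq_bigr do rewrite big_ord0.
  rewrite sumr_const -[leRHS]/(1%:R) ler_nat; apply/card_le1_eqP => s t sF tF.
  by apply: injf => // -[].
set A := [set f s ord0 | s in F].
have fA s : s \in F -> f s ord0 \in A by move=> sF; apply: imset_f.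
rewrite (partition_big _ _ fA) /=.
have [A0|A_gt0] := posnP #|A|.
  by rewrite (cards0_eq A0) big_set0 ler01.
suff le_a a : a \in A -> \sum_(s in F | f s ord0 == a)
    \prod_(i < n.+1) (#|branches f F s i|%:R)^-1 <= #|A|%:R^-1 :> K.
  apply: le_trans (ler_sum _ le_a) _.
  by rewrite sumr_const -[_ *+ _]mulr_natl divff // pnatr_eq0 -lt0n.
move=> _; set Fa := [set s in F | f s ord0 == a].
have injfa : {in Fa &, forall s t,
    (fun j => f s (lift ord0 j)) =1 (fun j => f t (lift ord0 j)) -> s = t}.
  move=> s t; rewrite !inE => /andP[sF /eqP sa] /andP[tF /eqP ta] eqst.
  apply: injf => // j; case: (unliftP ord0 j) => [k|] ->; first exact: eqst.
  by rewrite sa ta.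
(* The factor of coordinate 0 is 1 / #|A|; induction bounds the others. *)
apply: le_trans (_ : #|A|%:R^-1 * 1 <= _); last by rewrite mulr1.
apply: le_trans (ler_wpM2l _ (IHn _ _ injfa)); last by rewrite invr_ge0 ler0n.
rewrite mulr_sumr le_eqVlt; apply/orP; left; apply/eqP.
apply: eq_big => [s|s /andP[sF /eqP sa]]; first by rewrite inE.
rewrite big_ord_recl branches_ord0 -/A; congr (_ * _).
by apply: eq_bigr => i _; rewrite branches_lift sa.
Qed.

(** * Families with even pairwise agreements *)

Lemma even_agreement n (F : {set 'S_n}) : ~~ odd n -> even_intersecting F ->
  {in F &, forall s t, ~~ odd #|agreement s t|}.
Proof.
move=> evn evF s t sF tF; have [<-|neq_st] := eqVneq s t.
  have -> : agreement s s = [set: 'I_n]%SET.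
    by apply/setP => i; rewrite !inE eqxx.
  by rewrite cardsT card_ord.
by have /forall_inP/(_ s sF)/forall_inP/(_ t tF)/implyP := evF; apply.
Qed.

Lemma odd_agreement n (s t : 'S_n) :
  odd #|agreement s t| = \big[addb/false]_k (s k == t k).
Proof.
rewrite -sum1_card (big_morph odd oddD (erefl _)) big_mkcond /=.
by apply: eq_bigr => k _; rewrite inE; case: eqP.
Qed.

(** Parity: off i, one or three of the pairs st, su, tu agree, so the three
    agreement sets, all of even size, contribute n - 1 modulo 2 off i; this is
    odd, hence one of the pairs agrees at i, and it can only be tu. *)
Lemma two_sided_unique n (F : {set 'S_n}) (s t u : 'S_n) (i : 'I_n) :
    ~~ odd n -> even_intersecting F -> s \in F -> t \in F -> u \in F ->
    (forall j : 'I_n, (j < i)%N -> t j = s j) ->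
    (forall j : 'I_n, (i < j)%N -> u j = s j) ->
  t i != s i -> u i != s i -> t i = u i.
Proof.
move=> evn evF sF tF uF eqt equ neqt nequ; apply/eqP.
have ev := even_agreement evn evF.
have: odd #|agreement s t| (+) odd #|agreement s u|
  (+) odd #|agreement t u| = false.
  by rewrite (negPf (ev _ _ sF tF)) (negPf (ev _ _ sF uF))
    (negPf (ev _ _ tF uF)).
rewrite !odd_agreement -!big_split /= (bigD1 i) //=.
rewrite [s i == t i]eq_sym [s i == u i]eq_sym (negPf neqt) (negPf nequ) /=.
(* Off i, where s = t or s = u, the number of agreeing pairs is odd. *)
rewrite (eq_bigr (fun=> odd 1)); last first.
  move=> j; rewrite neq_ltn => /orP[/eqt ->|/equ ->]; rewrite eqxx.
    by case: eqP.
  by rewrite [s j == t j]eq_sym; case: eqP.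
rewrite -(big_morph odd oddD (erefl (odd 0))) sum1_card cardC1 card_ord.
have n_gt0 : (0 < n)%N by exact: leq_ltn_trans (ltn_ord i).
have -> : odd n.-1 by rewrite -[odd _]negbK -oddS prednK.
by rewrite addbT => /negbFE.
Qed.

(** If both sets have a point other than x, then there is only one such point,
    and both have two elements: this is where #|U| >= 4 matters. *)
Lemma card_mul_le (U : finType) (A B : {set U}) x :
    (4 <= #|U|)%N -> x \in A -> x \in B ->
    (forall a b, a \in A -> b \in B -> a != x -> b != x -> a = b) ->
  (#|A| * #|B| <= #|U|)%N.
Proof.
move=> U4 xA xB eqAB.
rewrite (cardsD1 x A) (cardsD1 x B) xA xB.
have [A0|[a aA]] := set_0Vmem (A :\ x).
  by rewrite A0 cards0 mul1n -[X in (X + _)%N]/(nat_of_bool true) -xB -cardsD1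
    max_card.
have [B0|[b bB]] := set_0Vmem (B :\ x).
  by rewrite B0 cards0 muln1 -[X in (X + _)%N]/(nat_of_bool true) -xA -cardsD1
    max_card.
have sub1 (C : {set U}) c : (forall d, d \in C -> d = c) -> (#|C| <= 1)%N.
  by move=> eqC; apply/card_le1_eqP => d e /eqC -> /eqC ->.
apply: leq_trans (_ : (1 + 1) * (1 + 1) <= _)%N => //.
move: aA bB; rewrite !inE => /andP[nax aA] /andP[nbx bB].
apply: leq_mul; rewrite leq_add2l.
- by apply: (sub1 _ b) => d; rewrite !inE => /andP[ndx dA]; apply: eqAB.
- by apply: (sub1 _ a) => d; rewrite !inE => /andP[ndx dB]; apply/esym/eqAB.
Qed.

(** The weights of the forward and the backward revelation are compared through
    the arithmetic-geometric mean inequality, applied to each s. *)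
Lemma card_even_intersecting_le n (F : {set 'S_n}) :
  ~~ odd n -> (4 <= n)%N -> even_intersecting F -> (#|F| <= n ^ n./2)%N.
Proof.
move=> evn n4 evF.
(* Backward revelation is forward revelation of s \o rev_ord. *)
pose fw (s : 'S_n) i := s i; pose bw (s : 'S_n) i := s (rev_ord i).
pose A s i := branches fw F s i.
pose B s i := branches bw F s (rev_ord i).
have AB s i : s \in F -> (0 < #|A s i| * #|B s i| <= n)%N.
  move=> sF; have sA : s i \in A s i.
    by apply/imsetP; exists s; rewrite // inE sF; apply/forall_inP.
  have sB : s i \in B s i.
    apply/imsetP; exists s; last by rewrite /bw rev_ordK.
    by rewrite inE sF; apply/forall_inP.
  apply/andP; split.
    by rewrite muln_gt0; apply/andP; split; apply/card_gt0P; exists (s i).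
  rewrite -[leqRHS](card_ord n); apply: card_mul_le sA sB _.
    by rewrite card_ord.
  move=> a b /imsetP[t /[!inE] /andP[tF /forall_inP eqt] ->].
  move=> /imsetP[u /[!inE] /andP[uF /forall_inP equ] ->].
  rewrite /bw rev_ordK /fw.
  apply: (two_sided_unique (s := s) evn evF sF tF uF) => // j ltj.
    exact/eqP/eqt.
  apply/eqP; have := equ (rev_ord j); rewrite /bw rev_ordK; apply => /=.
  by rewrite ltn_sub2l // (leq_ltn_trans ltj).
have sumA : \sum_(s in F) \prod_(i < n) #|A s i|%:R^-1 <= 1 :> rat.
  by apply: sum_branches_le1 => s t _ _ eqst; apply/permP.
have sumB : \sum_(s in F) \prod_(i < n) #|B s i|%:R^-1 <= 1 :> rat.
  under eq_bigr do rewrite (reindex_inj rev_ord_inj) /=.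
  under eq_bigr do under eq_bigr do rewrite /B rev_ordK.
  apply: sum_branches_le1 => s t _ _ eqst; apply/permP => i.
  by have := eqst (rev_ord i); rewrite /bw rev_ordK.
have n_gt0 : (0 < n)%N by exact: ltn_trans n4.
have wAB s : s \in F ->
    2 * (n ^ n./2)%:R^-1 <= \prod_(i < n) #|A s i|%:R^-1
      + \prod_(i < n) #|B s i|%:R^-1 :> rat.
  move=> sF; set p := \prod_(i < n) _; set q := \prod_(i < n) _.
  have p0 : 0 <= p by apply: prodr_ge0 => i _; rewrite invr_ge0 ler0n.
  have q0 : 0 <= q by apply: prodr_ge0 => i _; rewrite invr_ge0 ler0n.
  have pq : (n ^ n./2)%:R^-1 ^+ 2 <= p * q.
    rewrite exprVn -natrX -expnM muln2 even_halfK // /p /q -big_split /=.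
    under eq_bigr do rewrite -invfM -natrM.
    rewrite natrX -exprVn -[X in _ ^+ X](card_ord n) -prodr_const.
    apply: ler_prod => i _; have /andP[AB0 ABn] := AB s i sF.
    rewrite invr_ge0 ler0n /=.
    by rewrite lef_pV2 ?posrE ?ltr0n // ler_nat.
  rewrite -ler_sqr ?nnegrE ?addr_ge0 ?mulr_ge0 ?invr_ge0 ?ler0n //.
  rewrite exprMn; apply: le_trans (_ : 2 ^+ 2 * (p * q) <= _).
    by rewrite ler_wpM2l.
  rewrite -subr_ge0.
  have -> : (p + q) ^+ 2 - 2 ^+ 2 * (p * q) = (p - q) ^+ 2 :> rat.
    by ring.
  exact: sqr_ge0.
have le2 : \sum_(s in F) 2 * (n ^ n./2)%:R^-1 <= 1 + 1 :> rat.
  by apply: le_trans (ler_sum _ wAB) _; rewrite big_split; apply: lerD.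
have N0 : 0 < (n ^ n./2)%:R :> rat by rewrite ltr0n expn_gt0 n_gt0.
move: le2; rewrite sumr_const -[leLHS]mulr_natl mulrCA -[1 + 1]/(2 : rat).
rewrite -[leRHS]mulr1.
by rewrite ler_pM2l // ler_pdivrMr // mul1r ler_nat.
Qed.

(** * Comparison with the double factorial *)

(** m ^ m / m! is a term of the power series of exp m. *)
Lemma expn_self_le (R : realType) m : (m ^ m)%:R <= expR m%:R * m`!%:R :> R.
Proof.
case: m => [|m]; first by rewrite mulr1 expR0.
rewrite -ler_pdivrMr ?ltr0n ?fact_gt0 // natrX.
have := expR_ge1Dxn m (ler0n R m.+1).
by apply: le_trans; rewrite lerDr.
Qed.

Lemma double_fact_half n : ~~ odd n -> double_fact n = (2 ^ n./2 * n./2`!)%N.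
Proof.
move=> evn; rewrite -[in LHS](even_halfK evn); elim: n./2 => // m IHm.
by rewrite doubleS /= IHm expnS factS -doubleS -muln2
  [(m.+1 * 2)%N]mulnC mulnACA.
Qed.

Lemma expn_half_le (R : realType) n : ~~ odd n ->
  (n ^ n./2)%:R <= expR (n%:R / 2) * (double_fact n)%:R :> R.
Proof.
move=> evn; rewrite (double_fact_half evn); set m := n./2.
have -> : n%:R / 2 = m%:R :> R.
  by rewrite -(even_halfK evn) -muln2 natrM mulfK // pnatr_eq0.
rewrite -{1}(even_halfK evn) -/m -mul2n expnMn !natrM mulrCA.
by rewrite ler_wpM2l ?ler0n ?expn_self_le.
Qed.

(** * The wreath product *)

Lemma ltn_double_even n k : ~~ odd n -> (k.*2 < n)%N = (k < n./2)%N.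
Proof. by move=> evn; rewrite -{1}(even_halfK evn) ltn_double. Qed.

Lemma ltn_half_even n k : ~~ odd n -> (k < n)%N = (k./2 < n./2)%N.
Proof.
by move=> evn; rewrite -{1}(even_halfK evn) ltn_half_double.
Qed.

Definition block n (k : nat) : {set 'I_n} := [set i : 'I_n | i./2 == k :> nat].

Lemma pair_partitionE n : pair_partition n = [set block n k | k : 'I_n./2].
Proof.
apply: eq_imset => k; apply/setP => i; rewrite !inE.
rewrite -{1 2}(odd_double_half i); case: (odd i); rewrite ?add0n ?add1n.
- rewrite eqSS (inj_eq double_inj) orbC; case: eqP => //= _.
  by apply/negP => /eqP /(congr1 odd); rewrite /= !odd_double.
- rewrite (inj_eq double_inj); case: eqP => //= _.
  by apply/negP => /eqP /(congr1 odd); rewrite /= !odd_double.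
Qed.

(** The default value of [insubd] is reached only for the last point of an
    odd n; for even n this is the involution that swaps each pair. *)
Definition partner n (i : 'I_n) : 'I_n := insubd i (~~ odd i + i./2.*2)%N.

Lemma partnerE n (i : 'I_n) : ~~ odd n ->
  partner i = (~~ odd i + i./2.*2)%N :> nat.
Proof.
move=> evn; rewrite val_insubd ifT // ltn_half_even // half_bit_double.
by rewrite -ltn_half_even.
Qed.

Lemma half_partner n (i : 'I_n) : ~~ odd n -> (partner i)./2 = i./2.
Proof. by move=> evn; rewrite partnerE // half_bit_double. Qed.

Lemma odd_partner n (i : 'I_n) : ~~ odd n -> odd (partner i) = ~~ odd i.
Proof.
by move=> evn; rewrite partnerE // oddD odd_double addbF oddb.
Qed.

Lemma ord_half_odd_inj n (i j : 'I_n) : i./2 = j./2 -> odd i = odd j -> i = j.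
Proof.
move=> eqh eqo; apply: val_inj.
by rewrite /= -(odd_double_half i) eqh eqo odd_double_half.
Qed.

Lemma partnerK n : ~~ odd n -> involutive (@partner n).
Proof.
move=> evn i; apply: ord_half_odd_inj; first by rewrite !half_partner.
by rewrite !odd_partner // negbK.
Qed.

Lemma blockP n (i j : 'I_n) : ~~ odd n -> i./2 = j./2 -> i = j \/ i = partner j.
Proof.
move=> evn eqh; have [eqo|neqo] := eqVneq (odd i) (odd j).
  by left; apply: ord_half_odd_inj.
right; apply: ord_half_odd_inj; first by rewrite half_partner.
by rewrite odd_partner //; case: odd neqo; case: odd.
Qed.

(** Preserving the partition into pairs means commuting with the involution that
    has these pairs as orbits. *)
Lemma mem_wreath_S2 n (s : 'S_n) : ~~ odd n ->
  reflect (forall i, s (partner i) = partner (s i)) (s \in wreath_S2 n).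
Proof.
move=> evn.
have half_lt (i : 'I_n) : (i./2 < n./2)%N by rewrite -ltn_half_even.
have in_pairs (i : 'I_n) : block n i./2 \in pair_partition n.
  by rewrite pair_partitionE; apply/imsetP; exists (Ordinal (half_lt i)).
apply: (iffP idP) => [/astabsP stab i | comm].
- have := in_pairs i; rewrite -stab /= setactE pair_partitionE.
  case/imsetP => k _ eqk.
  have img (l : 'I_n) : l./2 = i./2 -> (s l)./2 = k.
    move=> eql; have : s l \in block n k.
      by rewrite -eqk; apply/imsetP; exists l; rewrite ?inE ?eql.
    by rewrite inE => /eqP.
  have : (s (partner i))./2 = (s i)./2 by rewrite !img ?half_partner.
  case/(blockP evn) => // /perm_inj /(congr1 (odd \o val)) /=.
  by rewrite odd_partner //; case: odd.
- rewrite !inE /=; apply/fintype.subsetP => A.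
  rewrite pair_partitionE => /imsetP[k _ ->].
  have lt2k : (k.*2 < n)%N by rewrite ltn_double_even.
  pose i := Ordinal lt2k; have hi : i./2 = k by rewrite /= doubleK.
  rewrite inE setactE -pair_partitionE.
  suff -> : [set 'P%act x s | x in block n k] = block n (s i)./2 by [].
  apply/setP => j; rewrite inE; apply/imsetP/eqP => [[l] | ].
    rewrite inE -hi => /eqP /(blockP evn)[] -> -> //=.
    by rewrite apermE comm half_partner.
  case/(blockP evn) => ->; first by exists i; rewrite // inE hi.
  by exists (partner i); rewrite ?inE ?half_partner ?hi //= apermE comm.
Qed.

(** The involution changes the parity of points, so it matches the odd members
    of A with the even ones. *)
Lemma even_card_partner n (A : {set 'I_n}) :
  ~~ odd n -> (forall i, i \in A -> partner i \in A) -> ~~ odd #|A|.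
Proof.
move=> evn invA; pose O := [set i : 'I_n | odd i].
suff eqC : #|A :&: O| = #|A :\: O|.
  by rewrite -(cardsID O A) eqC addnn odd_double.
rewrite -(card_imset _ (can_inj (partnerK evn))).
apply: eq_card => i; rewrite !inE; apply/imsetP/andP => [[j] | [nOi iA]].
  by rewrite !inE => /andP[/invA jA oj] ->; rewrite odd_partner // oj.
by exists (partner i); rewrite ?partnerK // !inE invA // odd_partner.
Qed.

Lemma even_intersecting_wreath_S2 n :
  ~~ odd n -> even_intersecting (wreath_S2 n).
Proof.
move=> evn; apply/forall_inP => s /(mem_wreath_S2 _ evn) cs.
apply/forall_inP => t /(mem_wreath_S2 _ evn) ct; apply/implyP => _.
apply: even_card_partner => // i; rewrite !inE => /eqP eqst.
by rewrite cs ct eqst.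
Qed.

(** An element of the wreath product is encoded by the permutation p it induces
    on the pairs and the bits b that tell which pairs are swapped: it sends
    2k + c to 2 (p k) + (c xor b k). *)
Lemma card_wreath_S2 n : ~~ odd n -> #|wreath_S2 n| = double_fact n.
Proof.
move=> evn; rewrite double_fact_half //; set m := n./2.
have lt_unpair (k : 'I_m) (b : bool) : (b + k.*2 < n)%N.
  by rewrite ltn_half_even // half_bit_double.
pose up k b := Ordinal (lt_unpair k b).
have lt_half (i : 'I_n) : (i./2 < m)%N by rewrite -ltn_half_even.
pose hf i := Ordinal (lt_half i).
have hf_up k b : hf (up k b) = k by apply: val_inj; rewrite /= half_bit_double.
have odd_up k b : odd (up k b) = b by rewrite oddD odd_double addbF oddb.
have up_hf i : up (hf i) (odd i) = i.
  by apply: val_inj; rewrite /= odd_double_half.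
have partner_up k b : partner (up k b) = up k (~~ b).
  by apply: val_inj; rewrite /= partnerE // odd_up /= half_bit_double.
pose act (pb : 'S_m * {ffun 'I_m -> bool}) i :=
  up (pb.1 (hf i)) (odd i (+) pb.2 (hf i)).
have act_inj pb : injective (act pb).
  move=> i j eqij; have := congr1 hf eqij; rewrite /act !hf_up => /perm_inj eqh.
  have := congr1 (odd \o val) eqij; rewrite /= !odd_up eqh.
  by move/addIb => eqo; rewrite -[i]up_hf -[j]up_hf eqh eqo.
pose wr pb := perm (act_inj pb).
have wr_inj : injective wr.
  move=> [p b] [q c] eqw.
  have eqk k : up (p k) (b k) = up (q k) (c k).
    by have := congr1 (fun s : 'S_n => s (up k false)) eqw;
      rewrite !permE /act !hf_up !odd_up.
  congr (_, _); [apply/permP|apply/ffunP] => k.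
    by have := congr1 hf (eqk k); rewrite !hf_up.
  by have := congr1 (fun i : 'I_n => odd i) (eqk k); rewrite !odd_up.
have <- : #|[set wr pb | pb in [set: 'S_m * {ffun 'I_m -> bool}]%SET]|
    = (2 ^ m * m`!)%N.
  rewrite card_imset // cardsT card_prod card_Sn card_ffun card_bool card_ord.
  exact: mulnC.
apply: eq_card => s; apply/(mem_wreath_S2 _ evn)/imsetP => [comm | [pb _ ->] i].
- pose p k := hf (s (up k false)).
  have sE k b : s (up k b) = up (p k) (b (+) odd (s (up k false))).
    case: b; last by rewrite /p up_hf.
    by rewrite -[true]/(~~ false) -partner_up comm -[s _]up_hf partner_up up_hf.
  have p_inj : injective p.
    move=> k l eqp; set b := odd (s (up k false)) (+) odd (s (up l false)).
    have : s (up k false) = s (up l b).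
      by rewrite [LHS]sE [RHS]sE eqp /b addbK.
    by move/perm_inj/(congr1 hf); rewrite !hf_up.
  exists (perm p_inj, [ffun k => odd (s (up k false))]); rewrite ?inE //.
  by apply/permP => i; rewrite permE /act /= permE ffunE -sE up_hf.
- by rewrite !permE /act -[i]up_hf !partner_up !hf_up !odd_up addNb.
Qed.

Theorem theorem1 (R : realType) :
  exists (C : R) (n0 : nat), 0 < C /\
    forall n : nat, ~~ odd n -> (n0 <= n)%N ->
      [/\ (double_fact n <= max_even_intersecting n)%N,
          (max_even_intersecting n)%:R <=
            expR (n%:R / 2 + C * n%:R `^ (3 / 4) * ln n%:R)
              * (double_fact n)%:R :> R,
          even_intersecting (wreath_S2 n)
        & #|wreath_S2 n| = double_fact n].
Proof.
(* The bound expR (n / 2) * n!! holds from n = 4 on, and for C > 0 the term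
   C * n `^ (3 / 4) * ln n can only increase the right-hand side. *)
exists 1, 4; split=> // n evn n4.
have evW := even_intersecting_wreath_S2 evn.
split=> //; last exact: card_wreath_S2.
- rewrite -(card_wreath_S2 evn).
  exact: (leq_bigmax_cond (gval (wreath_S2 n)) evW).
- apply: le_trans (_ : (n ^ n./2)%:R <= _).
    rewrite ler_nat; apply/bigmax_leqP => F.
    exact: card_even_intersecting_le.
  apply: le_trans (expn_half_le R evn) _; rewrite ler_wpM2r ?ler0n //.
  rewrite ler_expR lerDl mul1r mulr_ge0 ?powR_ge0 // ln_ge0 //.
  by rewrite ler1n (leq_trans _ n4).
Qed.
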